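(* Let $\Lambda\subseteq\Upsilon_n$ be an index set of cardinality $m>0$ with real root matrix $Y$, and let $\dim\operatorname{Null}(Y^T)=d>0$. Assume that any pair of isomorphic Lie algebras in $\mathcal S_\Lambda(\mathbb R)$ lie in the same orbit of the diagonal subgroup $D_n$ of $GL_n(\mathbb R)$ under the action $(g\cdot\alpha)(x,y)=g\,\alpha(g^{-1}x,g^{-1}y)$. Let $T\subseteq\mathbb Z_2^m$ be a simple cross section for the action $\rho_{\hat Y}$, let $S\subseteq(\mathbb R_{>0})^m$ be a $d$-dimensional subset with parametrization $\mathbf a: D\to S$ (a bijection from a subset $D$ of $\mathbb R^d$ onto $S$), and let $\Sigma(T,S)=\{\mathbf t\bullet\mathbf x : \mathbf t\in T,\ \mathbf x\in S\}$. Let $c\neq0$ be real, and let $F_c: D\to\mathbb R^d$ be the map $F_c=c\,(\pi_Y\circ\operatorname{Ln}\circ\,\mathbf a)$. If $F_c$ is onto $\mathbb R^d$, then every Lie algebra in $\mathcal S_\Lambda(\mathbb R)$ is isomorphic to a Lie algebra in $\Sigma(T,S)$. If in addition $F_c$ is one-to-one, then every Lie algebra defined by a Lie bracket in $\mathcal L_\Lambda(\mathbb R)$ is isomorphic to precisely one Lie algebra in $\Sigma(T,S)\cap\mathcal L_\Lambda(\mathbb R)$.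
   Context: Notation. $[n]=\{1,\dots,n\}$; $\Upsilon_n=\{(i,j,k)\in[n]^3 : i<j\}$, with a fixed ordering. An index set is a subset of $\Upsilon_n$. Fix a basis $x_1,\dots,x_n$ of $\mathbb R^n$. An element $\alpha\in\wedge^2(\mathbb R^n)^*\otimes\mathbb R^n$ is a skew-symmetric bilinear map with structure constants given by $\alpha(x_i,x_j)=\sum_k\alpha_{ij}^kx_k$; it defines an algebra $\mathfrak g_\alpha$ on $\mathbb R^n$. $\mathcal S_\Lambda(\mathbb R)$ is the set of $\alpha$ such that, for all $(i,j,k)\in\Upsilon_n$, $\alpha_{ij}^k\ne0$ if and only if $(i,j,k)\in\Lambda$; it is identified with $(\mathbb R\setminus\{0\})^m$ via $\alpha\mapsto[\alpha_{ij}^k]_{(i,j,k)\in\Lambda}$. $\mathcal L_\Lambda(\mathbb R)$ is the set of $\alpha\in\mathcal S_\Lambda(\mathbb R)$ satisfying the Jacobi Identity. A ''Lie algebra in'' a subset of $\mathcal S_\Lambda(\mathbb R)$ means (the Lie algebra $\mathfrak g_\alpha$ defined by) an element $\alpha$ of that subset satisfying the Jacobi Identity. The diagonal subgroup $D_n$ is the group of invertible matrices that are diagonal with respect to the fixed basis. Root matrices. The real root matrix $Y$ of $\Lambda$ is the $m\times n$ matrix whose rows are the vectors $\mathbf e_i^T+\mathbf e_j^T-\mathbf e_k^T$, $(i,j,k)\in\Lambda$, in the fixed order; $\hat Y$ is the analogous matrix over the field $\mathbb Z_2$. Actions. An $m\times n$ matrix $Z$ over a field $K$ defines an action $\rho_Z$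 of the additive group $K^n$ on $K^m$ by $\rho_Z(\mathbf d,\mathbf z)=\mathbf z+Z\mathbf d$. Thus $\rho_{\hat Y}$ is an action of $\mathbb Z_2^n$ on $\mathbb Z_2^m$. A simple cross section for an action is a set meeting each orbit exactly once. $\mathbb Z_2^m=\{0,1\}^m$ acts on $\mathbb R^m$ by $(s_1,\dots,s_m)\bullet(a_1,\dots,a_m)=((-1)^{s_1}a_1,\dots,(-1)^{s_m}a_m)$. Thus $\Sigma(T,S)\subseteq(\mathbb R\setminus\{0\})^m=\mathcal S_\Lambda(\mathbb R)$. $\operatorname{Ln}:(\mathbb R_{>0})^m\to\mathbb R^m$ is the coordinatewise natural logarithm. $\pi_Y:\mathbb R^m\to\mathbb R^d$ is the map $\pi_Y(\mathbf v)=(\mathbf v\cdot\mathbf w_1,\dots,\mathbf v\cdot\mathbf w_d)$, where $\{\mathbf w_1,\dots,\mathbf w_d\}$ is a (fixed) basis of $\operatorname{Null}(Y^T)$ and $\cdot$ is the dot product. *)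

(* Defs.v *)
From HB Require Import structures.
From mathcomp Require Import all_boot all_order all_algebra sesquilinear.
From mathcomp Require Import all_classical all_reals all_analysis.

Set Implicit Arguments.
Unset Strict Implicit.
Unset Printing Implicit Defensive.

Import Order.TTheory GRing.Theory Num.Theory.

Local Open Scope classical_set_scope.
Local Open Scope ring_scope.

(* The index triple (i, j, k) is ((i, j), k), with indices in 0, ..., n-1. *)
Definition Upsilon (n : nat) : {set 'I_n * 'I_n * 'I_n} :=
  [set t : 'I_n * 'I_n * 'I_n | (t.1.1 < t.1.2)%N].

(* lam lists the elements of L, each once, in the chosen order; an ordering of
   L is the same thing as the restriction to L of some ordering of Upsilon n. *)
Definition enumerates (n m : nat) (lam : m.-tuple ('I_n * 'I_n * 'I_n))
    (L : {set 'I_n * 'I_n * 'I_n}) : Prop :=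
  uniq lam /\ lam =i L.

Definition root_matrix (K : fieldType) (n m : nat)
    (lam : m.-tuple ('I_n * 'I_n * 'I_n)) : 'M[K]_(m, n) :=
  \matrix_(l < m) (delta_mx 0 (tnth lam l).1.1 + delta_mx 0 (tnth lam l).1.2
                   - delta_mx 0 (tnth lam l).2).

Section Algebras.
Context (R : realType) (n : nat).
Notation V := 'cV[R]_n.
Implicit Types (x : n.-tuple V) (alpha beta : V -> V -> V).

Definition skew_bilinear alpha : Prop :=
  bilinear_for *:%R *:%R alpha /\ forall u v : V, alpha u v = - alpha v u.

Definition jacobi alpha : Prop :=
  forall u v w : V,
    alpha (alpha u v) w + alpha (alpha v w) u + alpha (alpha w u) v = 0.

Definition struct_const x alpha (t : 'I_n * 'I_n * 'I_n) : R :=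
  coord x t.2 (alpha (tnth x t.1.1) (tnth x t.1.2)).

Definition S_ x (L : {set 'I_n * 'I_n * 'I_n}) : set (V -> V -> V) :=
  [set alpha | skew_bilinear alpha /\
    forall t, t \in Upsilon n -> (struct_const x alpha t <> 0 <-> t \in L)].

Definition L_ x (L : {set 'I_n * 'I_n * 'I_n}) : set (V -> V -> V) :=
  S_ x L `&` jacobi.

Definition struct_vec x (m : nat) (lam : m.-tuple ('I_n * 'I_n * 'I_n)) alpha :
    'cV[R]_m :=
  \col_l struct_const x alpha (tnth lam l).

(* A set A of vectors in R^m, read as a set of brackets through the
   identification of S_ x L with (R \ {0})^m. *)
Definition brackets_of x (L : {set 'I_n * 'I_n * 'I_n}) (m : nat)
    (lam : m.-tuple ('I_n * 'I_n * 'I_n)) (A : set 'cV[R]_m) :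
    set (V -> V -> V) :=
  [set alpha | S_ x L alpha /\ A (struct_vec x lam alpha)].

Definition isomorphic alpha beta : Prop :=
  exists g : {linear V -> V},
    bijective g /\ forall u v : V, g (alpha u v) = beta (g u) (g v).

Definition gl_act (g : 'M[R]_n) alpha : V -> V -> V :=
  fun u v => g *m alpha (invmx g *m u) (invmx g *m v).

Definition diag_subgroup x : set 'M[R]_n :=
  [set g | g \in unitmx /\
    forall i : 'I_n, exists c : R, g *m tnth x i = c *: tnth x i].

Definition diag_orbit x alpha : set (V -> V -> V) :=
  [set gl_act g alpha | g in diag_subgroup x].

End Algebras.

Definition rho (K : fieldType) (m n : nat) (Z : 'M[K]_(m, n))
    (d : 'cV[K]_n) (z : 'cV[K]_m) : 'cV[K]_m :=
  z + Z *m d.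

Definition rho_orbit (K : fieldType) (m n : nat) (Z : 'M[K]_(m, n))
    (z : 'cV[K]_m) : set 'cV[K]_m :=
  range (fun d => rho Z d z).

Definition simple_cross_section (K : fieldType) (m n : nat) (Z : 'M[K]_(m, n))
    (T : set 'cV[K]_m) : Prop :=
  forall z : 'cV[K]_m, exists! t, (T `&` rho_orbit Z z) t.

(* The exponent is the representative 0 or 1 of s l 0 in nat. *)
Definition sign_act (R : realType) (m : nat) (s : 'cV['F_2]_m) (a : 'cV[R]_m) :
    'cV[R]_m :=
  \col_l ((-1) ^+ (s l 0 : nat) * a l 0).

Definition Sigma (R : realType) (m : nat) (T : set 'cV['F_2]_m)
    (S : set 'cV[R]_m) : set 'cV[R]_m :=
  [set sign_act t a | t in T & a in S].

Definition positive_orthant (R : realType) (m : nat) : set 'cV[R]_m :=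
  [set a | forall l : 'I_m, 0 < a l 0].

Definition Ln (R : realType) (m : nat) (a : 'cV[R]_m) : 'cV[R]_m :=
  map_mx (@ln R) a.

Definition Null (K : fieldType) (p q : nat) (A : 'M[K]_(p, q)) :
    {vspace 'cV[K]_q} :=
  lker (linfun (mulmx A : 'cV[K]_q -> 'cV[K]_p)).

Definition dot (R : realType) (m : nat) (u v : 'cV[R]_m) : R :=
  \sum_l u l 0 * v l 0.

Definition pi_map (R : realType) (m d : nat) (w : d.-tuple 'cV[R]_m)
    (v : 'cV[R]_m) : 'cV[R]_d :=
  \col_p dot v (tnth w p).

Definition F_map (R : realType) (m d : nat) (c : R) (w : d.-tuple 'cV[R]_m)
    (a : 'cV[R]_d -> 'cV[R]_m) (u : 'cV[R]_d) : 'cV[R]_d :=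
  c *: pi_map w (Ln (a u)).

(* Main.v *)
From HB Require Import structures.
Require Import Defs.
From mathcomp Require Import all_boot all_order all_algebra.
From mathcomp Require Import all_classical all_reals all_analysis.
From mathcomp Require Import ring.

Set Implicit Arguments.
Unset Strict Implicit.
Unset Printing Implicit Defensive.

Import Order.TTheory GRing.Theory Num.Theory.
Local Open Scope classical_set_scope.
Local Open Scope ring_scope.

(** Write each vector with nonzero entries in polar form, [polar s v], as a
    vector [s] of signs over Z_2 and a vector [v] of logarithms of absolute
    values.  In these coordinates the diagonal subgroup acts by translations:
    the matrix scaling the basis vector [x_i] by [(-1)^(s_i) exp(- r_i)]
    multiplies the structure constant of index (i, j, k) by
    [(-1)^(s_i + s_j - s_k) exp(r_i + r_j - r_k)], that is, it adds [Yhat s] to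
    the signs and [Y r] to the logarithms ([struct_vec_diag]).  A diagonal orbit
    is therefore a pair consisting of an orbit of [rho Yhat] and a coset of the
    range of [Y].

    The cross section [T] has one representative in each orbit of [rho Yhat].
    The range of [Y] is the orthogonal complement of [Null Y^T], so [pi_map]
    takes equal values exactly at points of the same coset ([pi_map_eq]).  If
    [F_c] is onto, then [Ln S] meets every coset, whence every orbit meets
    [Sigma T S] and the corresponding diagonal matrix is the isomorphism.  If
    moreover [F_c] is one-to-one, then [Ln S] meets each coset once, and so
    [Sigma T S] meets each diagonal orbit once.  Two isomorphic brackets in
    [L_ x Lambda] lie in the same diagonal orbit by hypothesis, and a bracket in
    [S_ x Lambda] is determined by its vector of structure constants
    ([struct_vec_inj]); this gives uniqueness. *)

(** * Root matrices and the range of a matrix *)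

Section RootMatrix.
Variables (K : fieldType) (n m : nat) (lam : m.-tuple ('I_n * 'I_n * 'I_n)).

Lemma root_matrix_mulE (d : 'cV[K]_n) (l : 'I_m) :
  (root_matrix K lam *m d) l 0 =
    d (tnth lam l).1.1 0 + d (tnth lam l).1.2 0 - d (tnth lam l).2 0.
Proof.
have -> : (root_matrix K lam *m d) l 0 = row l (root_matrix K lam *m d) 0 0.
  by rewrite [RHS]mxE.
by rewrite row_mul rowK mulmxBl mulmxDl -!rowE !mxE.
Qed.

End RootMatrix.

Section NullSpace.
Variables (R : realType) (p m d : nat) (A : 'M[R]_(m, p)).

Lemma dotE (u v : 'cV[R]_m) : dot u v = (u^T *m v) 0 0.
Proof. by rewrite mxE; apply: eq_bigr => l _; rewrite mxE. Qed.

Lemma mem_Null q (B : 'M[R]_(q, m)) (v : 'cV[R]_m) : (v \in Null B) = (B *m v == 0).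
Proof. by rewrite memv_ker lfunE. Qed.

(** The inclusion of the orthogonal complement into the range of [A] comes from
    the cokernel matrix of [A^T]: its columns lie in [Null A^T], and they test
    membership in the row space of [A^T]. *)
Lemma orth_Null_tr (v : 'cV[R]_m) :
  (forall u, u \in Null A^T -> dot v u = 0) <-> exists r, v = A *m r.
Proof.
split=> [v_orth | [r ->] u]; last first.
  by rewrite mem_Null => /eqP Au0; rewrite dotE trmx_mul -mulmxA Au0 mulmx0 mxE.
have /submxP[r /(congr1 trmx)] : (v^T <= A^T)%MS; last first.
  by rewrite trmxK trmx_mul trmxK; exists r^T.
rewrite submxE; have := mulmx_coker A^T; move: (cokermx A^T) => C AC0.
apply/eqP/rowP => j; rewrite [RHS]mxE.
have -> : (v^T *m C) 0 j = dot v (col j C) by rewrite dotE colE mulmxA -colE [RHS]mxE.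
by apply: v_orth; rewrite mem_Null colE mulmxA AC0 mul0mx.
Qed.

Variables (w : d.-tuple 'cV[R]_m) (hw : basis_of (Null A^T) w).

Lemma pi_map_eq (u v : 'cV[R]_m) :
  pi_map w u = pi_map w v <-> exists r, u = rho A r v.
Proof.
have dotl (y z : 'cV[R]_m) : dot (u - v) z = dot u z - dot v z.
  by rewrite !dotE linearB mulmxBl !mxE.
split=> [pi_eq | [r ->]].
  have /orth_Null_tr[r uv] : forall z, z \in Null A^T -> dot (u - v) z = 0.
    move=> z /(coord_basis hw) ->; rewrite dotE linear_sum summxE.
    apply: big1 => i _ /=; rewrite -scalemxAr mxE -dotE dotl ?mulr0 //.
    move/colP: pi_eq => /(_ i); rewrite !mxE (tnth_nth 0) => ->.
    by rewrite subrr mulr0.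
  by exists r; rewrite /rho -uv addrC subrK.
apply/colP => q; rewrite !mxE /rho !dotE linearD mulmxDl mxE -!dotE.
have /orth_Null_tr -> : exists r', A *m r = A *m r' by exists r.
  by rewrite addr0.
by apply: (basis_mem hw); exact: mem_tnth.
Qed.

End NullSpace.

(** * Polar form of vectors with nonzero entries *)

Section PolarForm.
Variables (R : realType).

Definition polar k (s : 'cV['F_2]_k) (v : 'cV[R]_k) : 'cV[R]_k :=
  sign_act s (map_mx expR v).

Lemma polarE k (s : 'cV['F_2]_k) v l :
  polar s v l 0 = (-1) ^+ (s l 0 : nat) * expR (v l 0).
Proof. by rewrite !mxE. Qed.

Lemma polar_neq0 k (s : 'cV['F_2]_k) v l : polar s v l 0 != 0.
Proof. by rewrite polarE mulf_neq0 ?signr_eq0 // gt_eqF // expR_gt0. Qed.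

Lemma signF2D (a b : 'F_2) :
  (-1) ^+ ((a + b)%R : nat) = (-1) ^+ (a : nat) * (-1) ^+ (b : nat) :> R.
Proof. by rewrite /= modn2 signr_odd exprD. Qed.

Lemma signF2N (a : 'F_2) : (-1) ^+ ((- a)%R : nat) = (-1) ^+ (a : nat) :> R.
Proof. by congr (_ ^+ nat_of_ord _); apply: val_inj; case: a => [[|[|a]] a2]. Qed.

Lemma signF2_inj (a b : 'F_2) :
  (-1) ^+ (a : nat) = (-1) ^+ (b : nat) :> R -> a = b.
Proof.
have F2_odd (e : 'F_2) : odd e = e :> nat by case: e => [[|[|e]] e2].
rewrite -[in LHS]signr_odd -[in RHS]signr_odd => /signr_inj oddE.
by apply: val_inj; rewrite /= -[LHS]F2_odd -[RHS]F2_odd oddE.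
Qed.

Lemma polar_ex k (z : 'cV[R]_k) :
  (forall l, z l 0 != 0) -> exists s v, z = polar s v.
Proof.
move=> z_neq0.
exists (\col_l if z l 0 < 0 then 1 else 0), (\col_l ln `|z l 0|).
apply/colP => l; rewrite polarE !mxE lnK ?posrE ?normr_gt0 //.
rewrite [LHS]numEsign.
by case: ifP.
Qed.

Lemma polar_inj k (s s' : 'cV['F_2]_k) (v v' : 'cV[R]_k) :
  polar s v = polar s' v' -> s = s' /\ v = v'.
Proof.
move=> /colP eq_polar.
have v_eq l : v l 0 = v' l 0.
  move: (eq_polar l); rewrite !polarE => /(congr1 (fun y : R => ln `|y|)).
  by rewrite !normrMsign !ger0_norm ?expR_ge0 // !expRK.
split; apply/colP => l; last exact: v_eq.
move: (eq_polar l); rewrite !polarE v_eq => /mulIf.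
rewrite gt_eqF ?expR_gt0 // => /(_ isT).
exact: signF2_inj.
Qed.

Lemma sign_act_polar k (t : 'cV['F_2]_k) (a : 'cV[R]_k) :
  positive_orthant a -> sign_act t a = polar t (Ln a).
Proof.
by move=> a_gt0; apply/colP => l; rewrite polarE !mxE lnK ?posrE ?a_gt0.
Qed.

End PolarForm.

(** * Change of basis and isomorphism *)

Section Brackets.
Variables (R : realType) (n : nat).
Notation V := 'cV[R]_n.
Implicit Types (g h : 'M[R]_n) (alpha beta gamma : V -> V -> V).

Lemma eq_mulmx_cV p q (A B : 'M[R]_(p, q)) :
  (forall u : 'cV[R]_q, A *m u = B *m u) -> A = B.
Proof.
move=> AB; apply/matrixP => i j.
by have /colP/(_ i) := AB (delta_mx j 0); rewrite -!colE !mxE.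
Qed.

Lemma linear_cV_mx (f : {linear V -> V}) : exists M : 'M[R]_n, f =1 mulmx M.
Proof.
exists (lin1_mx (trmx \o f \o trmx))^T => u.
by rewrite -[u in RHS]trmxK -trmx_mul mul_rV_lin1 /= !trmxK.
Qed.

Lemma gl_actM g h alpha : g \in unitmx -> h \in unitmx ->
  gl_act (g *m h) alpha = gl_act g (gl_act h alpha).
Proof.
move=> gU hU; have ghU : g *m h \in unitmx by rewrite unitmx_mul gU.
have invE u : invmx (g *m h) *m u = invmx h *m (invmx g *m u).
  by apply: (can_inj (mulKmx ghU)); rewrite mulKVmx // -mulmxA !mulKVmx.
by apply/funext => u; apply/funext => v; rewrite /gl_act !invE -mulmxA.
Qed.

Lemma gl_act1 alpha : gl_act 1%:M alpha = alpha.
Proof.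
by apply/funext => u; apply/funext => v; rewrite /gl_act invmx1 !mul1mx.
Qed.

(** Passing from linear bijections to invertible matrices turns symmetry and
    transitivity of [isomorphic] into group laws for [gl_act]. *)
Lemma isomorphicP alpha beta :
  isomorphic alpha beta <-> exists2 g, g \in unitmx & beta = gl_act g alpha.
Proof.
split=> [[f [[f' fK f'K] f_morph]] | [g gU ->]]; last first.
  exists (mulmx g); split; first by exists (mulmx (invmx g)); [exact: mulKmx | exact: mulKVmx].
  by move=> u v; rewrite /gl_act !mulKmx.
have [M fM] := linear_cV_mx f.
pose lf' : {linear V -> V} :=
  HB.pack f' (GRing.isLinear.Build _ _ _ _ f' (can2_linear fK f'K)).
have [M' fM'] := linear_cV_mx lf'.
have MM' : M *m M' = 1%:M.
  by apply: eq_mulmx_cV => u; rewrite -mulmxA -fM' -fM mul1mx /= f'K.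
have [MU _] := mulmx1_unit MM'.
exists M => //; apply/funext => u; apply/funext => v.
by rewrite /gl_act -fM f_morph !fM !mulKVmx.
Qed.

Lemma isomorphic_sym alpha beta : isomorphic alpha beta -> isomorphic beta alpha.
Proof.
move/isomorphicP=> [g gU ->]; apply/isomorphicP; exists (invmx g).
  by rewrite unitmx_inv.
by rewrite -gl_actM ?unitmx_inv // mulVmx // gl_act1.
Qed.

Lemma isomorphic_trans alpha beta gamma :
  isomorphic alpha beta -> isomorphic beta gamma -> isomorphic alpha gamma.
Proof.
move/isomorphicP=> [g gU ->] /isomorphicP[h hU ->]; apply/isomorphicP.
by exists (h *m g); rewrite ?unitmx_mul ?hU // gl_actM.
Qed.

Lemma gl_act_skew_bilinear g alpha :
  skew_bilinear alpha -> skew_bilinear (gl_act g alpha).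
Proof.
move=> [[linl linr] skew]; split; last by move=> u v; rewrite /gl_act skew mulmxN.
split=> [v | u] b y z; rewrite /gl_act mulmxDr -scalemxAr.
  by rewrite linl mulmxDr -scalemxAr.
by rewrite linr mulmxDr -scalemxAr.
Qed.

Lemma gl_act_jacobi g alpha :
  g \in unitmx -> jacobi alpha -> jacobi (gl_act g alpha).
Proof.
by move=> gU jac u v z; rewrite /gl_act !mulKmx // -!mulmxDr jac mulmx0.
Qed.

(** * Matrices that are diagonal in the fixed basis *)

Variables (x : n.-tuple V) (hx : basis_of fullv x).

Lemma coord_sum (u : V) : u = \sum_i coord x i u *: tnth x i.
Proof.
rewrite [LHS](coord_basis hx) ?memvf //.
by apply: eq_bigr => i _; rewrite (tnth_nth 0).
Qed.

Lemma coord_tnth i j : coord x i (tnth x j) = (j == i)%:R.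
Proof. by rewrite (tnth_nth 0) coord_free // (basis_free hx). Qed.

Lemma eq_coord (u v : V) : (forall i, coord x i u = coord x i v) -> u = v.
Proof.
by move=> e; rewrite (coord_sum u) (coord_sum v); apply: eq_bigr => i _; rewrite e.
Qed.

Lemma eq_linear_basis (f h : V -> V) : linear f -> linear h ->
  (forall i, f (tnth x i) = h (tnth x i)) -> f =1 h.
Proof.
move=> lf lh e u.
pose f' : {linear V -> V} := HB.pack f (GRing.isLinear.Build _ _ _ _ f lf).
pose h' : {linear V -> V} := HB.pack h (GRing.isLinear.Build _ _ _ _ h lh).
rewrite -[f u]/(f' u) -[h u]/(h' u) (coord_sum u) !linear_sum.
by apply: eq_bigr => i _; rewrite !linearZ /= e.
Qed.

Lemma coord_diag (g : 'M[R]_n) (e : 'cV[R]_n) k (u : V) :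
  (forall i, g *m tnth x i = e i 0 *: tnth x i) ->
  coord x k (g *m u) = e k 0 * coord x k u.
Proof.
move=> ge; rewrite {1}(coord_sum u) mulmx_sumr linear_sum (bigD1 k) //=.
rewrite -scalemxAr ge !linearZ /= coord_tnth eqxx mulr1 big1 ?addr0 1?mulrC //.
move=> i /negPf ik; rewrite -scalemxAr ge !linearZ /=.
by rewrite coord_tnth ik !mulr0.
Qed.

(** The matrix with the inverse eigenvalues is the inverse matrix, which gives
    invertibility. *)
Lemma diag_ex (e : 'cV[R]_n) : (forall i, e i 0 != 0) ->
  exists2 g : 'M[R]_n, g \in unitmx &
    forall i, g *m tnth x i = e i 0 *: tnth x i.
Proof.
move=> e_neq0.
have mx_ex (b : 'cV[R]_n) :
    exists M : 'M[R]_n, forall i, M *m tnth x i = b i 0 *: tnth x i.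
  have [f] := linear_of_free x [tuple b i 0 *: tnth x i | i < n].
  rewrite !size_tuple (basis_free hx) => /(_ isT erefl) fx.
  have [M fM] := linear_cV_mx f; exists M => i; rewrite -fM.
  have -> : f (tnth x i) = nth 0 (map f x) i.
    by rewrite (nth_map 0) ?size_tuple // (tnth_nth 0).
  by rewrite fx -tnth_nth tnth_mktuple.
have [g ge] := mx_ex e; have [h he] := mx_ex (\col_i (e i 0)^-1).
exists g => //; have [//] : g \in unitmx /\ h \in unitmx.
apply: mulmx1_unit; apply: eq_mulmx_cV => u.
rewrite mul1mx -mulmxA; apply: eq_coord => k.
by rewrite (coord_diag _ _ ge) (coord_diag _ _ he) mxE mulVKf.
Qed.

Lemma struct_const_diag (g : 'M[R]_n) (e : 'cV[R]_n) alpha t :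
  g \in unitmx -> (forall i, e i 0 != 0) ->
  (forall i, g *m tnth x i = e i 0 *: tnth x i) -> skew_bilinear alpha ->
  struct_const x (gl_act g alpha) t =
    e t.2 0 / (e t.1.1 0 * e t.1.2 0) * struct_const x alpha t.
Proof.
move=> gU e_neq0 ge [[linl linr] _].
have gV i : invmx g *m tnth x i = (e i 0)^-1 *: tnth x i.
  by apply: (can_inj (mulKmx gU)); rewrite mulKVmx // -scalemxAr ge scalerK.
have Zl b u v : alpha (b *: u) v = b *: alpha u v.
  exact: GRing.scalable_linear (linl v) b u.
have Zr b u v : alpha v (b *: u) = b *: alpha v u.
  exact: GRing.scalable_linear (linr v) b u.
rewrite /struct_const /gl_act (coord_diag _ _ ge) !gV Zl Zr !linearZ /=.
by rewrite invfM !mulrA.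
Qed.

(** The logarithms are written [- r] to make [struct_vec_diag] a translation by
    [+ Y r]: the inverse of the diagonal matrix acts on the two arguments of the
    bracket, so eigenvalues enter with exponents opposite to those of the rows
    of [Y].  For signs the two conventions agree. *)
Lemma diag_subgroup_polar g : diag_subgroup x g ->
  exists s r, forall i, g *m tnth x i = polar s (- r) i 0 *: tnth x i.
Proof.
move=> [gU /choice[e ge]].
have [|s [r er]] := @polar_ex R n (\col_i e i).
  move=> i; rewrite mxE; apply/negP => /eqP ei0.
  have /(congr1 (coord x i)) : tnth x i = 0.
    by apply: (can_inj (mulKmx gU)); rewrite ge ei0 scale0r mulmx0.
  by rewrite coord_tnth linear0 eqxx => /eqP; rewrite oner_eq0.
by exists s, (- r) => i; rewrite opprK -er mxE.
Qed.

(** * Structure constants *)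

Variables (L : {set 'I_n * 'I_n * 'I_n}).

Lemma gl_act_S g (e : 'cV[R]_n) alpha :
  g \in unitmx -> (forall i, e i 0 != 0) ->
  (forall i, g *m tnth x i = e i 0 *: tnth x i) ->
  S_ x L alpha -> S_ x L (gl_act g alpha).
Proof.
move=> gU e_neq0 ge [skb supp]; split; first exact: gl_act_skew_bilinear.
move=> t /supp <-; rewrite (@struct_const_diag _ e) //.
have /negPf q_neq0 : e t.2 0 / (e t.1.1 0 * e t.1.2 0) != 0.
  by rewrite mulf_neq0 ?invr_eq0 ?mulf_neq0.
by split=> /eqP z; apply/eqP; move: z; rewrite mulf_eq0 q_neq0.
Qed.

Variables (m : nat) (lam : m.-tuple ('I_n * 'I_n * 'I_n)).

(** The diagonal action is translation by [Yhat s] and [Y r] in polar form,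
    since the scaling factor [e_k / (e_i e_j)] is the exponential of minus the
    row [e_i + e_j - e_k] of [Y] paired with the logarithms of the
    eigenvalues. *)
Lemma struct_vec_diag (g : 'M[R]_n) alpha s r z v :
  g \in unitmx ->
  (forall i, g *m tnth x i = polar s (- r) i 0 *: tnth x i) ->
  skew_bilinear alpha -> struct_vec x lam alpha = polar z v ->
  struct_vec x lam (gl_act g alpha) =
    polar (rho (root_matrix 'F_2 lam) s z) (rho (root_matrix R lam) r v).
Proof.
move=> gU ge skb /colP sv; apply/colP => l.
rewrite [LHS]mxE (@struct_const_diag _ (polar s (- r))) //; last first.
  by move=> i; exact: polar_neq0.
have -> : struct_const x alpha (tnth lam l) = polar z v l 0 by rewrite -sv mxE.
rewrite !polarE ![rho _ _ _ l 0]mxE !root_matrix_mulE.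
rewrite ![(- r) _ _]mxE !expRN !expRD expRN !signF2D signF2N !invfM !invr_sign !invrK.
by ring.
Qed.

Hypotheses (hL : L \subset Upsilon n) (lamL : lam =i L).

Lemma struct_vec_neq0 alpha : S_ x L alpha ->
  forall l, struct_vec x lam alpha l 0 != 0.
Proof.
move=> [_ supp] l; rewrite mxE; apply/eqP.
have lL : tnth lam l \in L by rewrite -lamL mem_tnth.
exact/(supp _ (fintype.subsetP hL _ lL)).
Qed.

(** The constants of index outside [L] vanish, those with i >= j are determined
    by skew-symmetry, and bilinearity does the rest. *)
Lemma struct_vec_inj alpha beta : S_ x L alpha -> S_ x L beta ->
  struct_vec x lam alpha = struct_vec x lam beta -> alpha = beta.
Proof.
move=> [[bila skewa] suppa] [[bilb skewb] suppb] /colP sv.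
have scE t : t \in Upsilon n -> struct_const x alpha t = struct_const x beta t.
  move=> tU; have [tL | tL] := boolP (t \in L).
    have /tnthP[l ->] : t \in lam by rewrite lamL.
    by have := sv l; rewrite !mxE.
  have zero gam : (struct_const x gam t <> 0 <-> t \in L) ->
      struct_const x gam t = 0.
    by move=> [imp _]; apply/eqP/negPn/negP => /eqP/imp; apply/negP.
  by rewrite (zero _ (suppa _ tU)) (zero _ (suppb _ tU)).
have basisE_lt (i j : 'I_n) : (i < j)%N ->
    alpha (tnth x i) (tnth x j) = beta (tnth x i) (tnth x j).
  by move=> ij; apply: eq_coord => k; apply: (scE (i, j, k)); rewrite inE.
have diag0 (gam : V -> V -> V) : (forall u v, gam u v = - gam v u) -> forall u, gam u u = 0.
  move=> skew u; apply/colP => i; rewrite [RHS]mxE.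
  have /colP/(_ i) := skew u u; rewrite [RHS]mxE => /esym/eqP.
  by rewrite eqNr => /eqP.
have basisE i j : alpha (tnth x i) (tnth x j) = beta (tnth x i) (tnth x j).
  case: (ltngtP i j) => [/basisE_lt // | ji | /val_inj ->].
    by rewrite skewa basisE_lt // -skewb.
  by rewrite !diag0.
apply/funext => u; apply/funext => v.
have basisEl i y : alpha (tnth x i) y = beta (tnth x i) y.
  exact: (eq_linear_basis (bila.2 _) (bilb.2 _) (basisE i)).
exact: (eq_linear_basis (bila.1 v) (bilb.1 v) (basisEl^~ v)).
Qed.

End Brackets.

Theorem theorem2p4 (R : realType) (n m d : nat)
    (x : n.-tuple 'cV[R]_n) (hx : basis_of fullv x)
    (Lambda : {set 'I_n * 'I_n * 'I_n}) (hLambda : Lambda \subset Upsilon n)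
    (hcard : #|Lambda| = m) (hm : (0 < m)%N)
    (lam : m.-tuple ('I_n * 'I_n * 'I_n)) (hlam : enumerates lam Lambda)
    (hdim : \dim (Null (root_matrix R lam)^T) = d) (hd : (0 < d)%N)
    (hiso : forall alpha beta : 'cV[R]_n -> 'cV[R]_n -> 'cV[R]_n,
       L_ x Lambda alpha -> L_ x Lambda beta -> isomorphic alpha beta ->
       diag_orbit x alpha beta)
    (T : set 'cV['F_2]_m)
    (hT : simple_cross_section (root_matrix 'F_2 lam) T)
    (S : set 'cV[R]_m) (hS : S `<=` @positive_orthant R m)
    (D : set 'cV[R]_d) (a : 'cV[R]_d -> 'cV[R]_m) (ha : set_bij D S a)
    (w : d.-tuple 'cV[R]_m)
    (hw : basis_of (Null (root_matrix R lam)^T) w)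
    (c : R) (hc : c <> 0) :
  (set_surj D setT (F_map c w a) ->
     forall alpha : 'cV[R]_n -> 'cV[R]_n -> 'cV[R]_n,
       L_ x Lambda alpha ->
       exists beta,
         (brackets_of x Lambda lam (Sigma T S) beta /\ jacobi beta) /\
         isomorphic alpha beta)
  /\
  (set_surj D setT (F_map c w a) -> set_inj D (F_map c w a) ->
     forall alpha : 'cV[R]_n -> 'cV[R]_n -> 'cV[R]_n,
       L_ x Lambda alpha ->
       exists! beta,
         (brackets_of x Lambda lam (Sigma T S) `&` L_ x Lambda) beta /\
         isomorphic alpha beta).
Proof.
have lamL := hlam.2.
(* Membership in [L_ x Lambda] is kept here because the existence half of the
   second part needs it. *)
have exist alpha : set_surj D setT (F_map c w a) -> L_ x Lambda alpha ->
    exists beta, (brackets_of x Lambda lam (Sigma T S) `&` L_ x Lambda) beta /\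
      isomorphic alpha beta.
  move=> F_surj [Salpha jac].
  have [z [v sv]] := polar_ex (struct_vec_neq0 hLambda lamL Salpha).
  have [t [[Tt [s _ zt]] _]] := hT z.
  have [u Du Fu] : (F_map c w a @` D) (c *: pi_map w v) by exact: F_surj.
  have /(pi_map_eq hw)[r ar] : pi_map w (Ln (a u)) = pi_map w v.
    by apply: scalerI Fu; apply/eqP.
  have [a_fun _ _] := ha; have Sau : S (a u) by apply: a_fun; exact: Du.
  have [g gU ge] := diag_ex hx (@polar_neq0 R n s (- r)).
  have Sbeta : S_ x Lambda (gl_act g alpha).
    exact: (gl_act_S hx gU (@polar_neq0 R n s (- r)) ge).
  exists (gl_act g alpha); split; last by apply/isomorphicP; exists g.
  split; last by split => //; exact: gl_act_jacobi.
  split=> //; rewrite (struct_vec_diag hx gU ge Salpha.1 sv) zt -ar.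
  by rewrite -sign_act_polar; [exists t => //; exists (a u) | exact: hS].
split=> [F_surj alpha La | F_surj F_inj alpha La].
  have [beta [[Bbeta [_ jacbeta]] iso]] := exist alpha F_surj La.
  by exists beta.
have [beta [Bbeta iso]] := exist alpha F_surj La.
exists beta; split=> // gam [[[Sgam [t' Tt' [b' Sb' sb']]] Lgam] iso'].
have [[Sbeta [t Tt [b Sb sb]]] Lbeta] := Bbeta.
apply: (struct_vec_inj hx lamL Sbeta Sgam); rewrite -sb -sb'.
have iso_bg : isomorphic beta gam.
  exact: isomorphic_trans (isomorphic_sym iso) iso'.
have [g diag_g g_gam] := hiso beta gam Lbeta Lgam iso_bg.
have [s [r ge]] := diag_subgroup_polar hx diag_g.
move: sb sb'; rewrite (sign_act_polar _ (hS _ Sb)) (sign_act_polar _ (hS _ Sb')).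
move=> /esym sb.
rewrite -g_gam (struct_vec_diag hx diag_g.1 ge Sbeta.1 sb).
move=> /polar_inj[t'E Ln'E].
(* [t] and [t'] both represent the orbit of [t] in the cross section. *)
have [t0 [_ t0_uniq]] := hT t.
have tE : t = t'.
  have t0t : t0 = t.
    by apply: t0_uniq; split=> //; exists 0; rewrite // /rho mulmx0 addr0.
  have t0t' : t0 = t' by apply: t0_uniq; split; [exact: Tt' | exists s].
  by rewrite -t0t -t0t'.
have [_ _ a_surj] := ha.
have [u Du ub] := a_surj _ Sb; have [u' Du' ub'] := a_surj _ Sb'.
have pi_eq : pi_map w (Ln b') = pi_map w (Ln b).
  by apply/(pi_map_eq hw); exists r.
have uE : u = u'.
  by apply: F_inj; rewrite ?inE // /F_map ub ub' pi_eq.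
by rewrite tE -ub -ub' uE.
Qed.
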